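(* Let $t\ge r\ge 2$ and $n\ge t$ be integers. For every $H\in\mathcal{B}_n(K_t^r)$, $$\rho\big(K_t^r\circ(n-t+1,1,1,\ldots,1)\big)\le \rho(H)\le \rho\big(T_t^r(n)\big),$$ where the left equality holds if and only if $H\cong K_t^r\circ(n-t+1,1,1,\ldots,1)$, and the right equality holds if and only if $H\cong T_t^r(n)$.
   Context: An $r$-uniform hypergraph $H$ has a finite vertex set $V(H)$ and an edge set $E(H)$ of $r$-element subsets of $V(H)$; its order is $|V(H)|$. If $V(H)=\{v_1,\ldots,v_n\}$, its adjacency tensor $\mathcal{A}(H)=(a_{i_1\cdots i_r})$ of order $r$ and dimension $n$ has $a_{i_1\cdots i_r}=\frac{1}{(r-1)!}$ if $\{v_{i_1},\ldots,v_{i_r}\}\in E(H)$ and $0$ otherwise. A number $\lambda\in\mathbb{C}$ is an eigenvalue of $\mathcal{A}(H)$ if there is $\mathbf{x}\in\mathbb{C}^n\setminus\{0\}$ with $\sum_{i_2,\ldots,i_r\in[n]}a_{ii_2\cdots i_r}x_{i_2}\cdots x_{i_r}=\lambda x_i^{r-1}$ for all $i\in[n]$. The spectral radius $\rho(H)$ is the maximum of $|\lambda|$ over all eigenvalues $\lambda$ of $\mathcal{A}(H)$. For an $r$-uniform hypergraph $G$ with $V(G)=[t]=\{1,\ldots,t\}$ and a vector $(n_1,\ldots,n_t)$ of positive integers, the blow-up $G\circ(n_1,\ldots,n_t)$ is the $r$-uniform hypergraph whose vertex set is a disjoint union $V_1\cup\cdots\cup V_t$ with $|V_j|=n_j$,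 and whose edges are exactly the sets $\{u_1,\ldots,u_r\}$ with $u_1\in V_{j_1},\ldots,u_r\in V_{j_r}$ for some $\{j_1,\ldots,j_r\}\in E(G)$. $\mathcal{B}_n(G)$ is the set of all $G\circ(n_1,\ldots,n_t)$ with all $n_i$ positive integers and $\sum_{i=1}^t n_i=n$. $K_t^r$ is the complete $r$-uniform hypergraph on $t$ vertices (all $r$-subsets are edges). $T_t^r(n)$ is the complete $t$-partite $r$-uniform hypergraph of order $n$ with parts of size $\lfloor n/t\rfloor$ or $\lceil n/t\rceil$: its vertex set is partitioned into $t$ such parts and its edges are all $r$-subsets containing at most one vertex from each part. $\cong$ denotes isomorphism of hypergraphs. *)

(* Defs.v *)
From mathcomp Require Import all_boot all_order all_algebra.
From mathcomp Require Import classical_sets reals.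
From mathcomp Require Import complex.
From mathcomp Require Import zify.

Set Implicit Arguments.
Unset Strict Implicit.
Unset Printing Implicit Defensive.

Import Order.TTheory GRing.Theory Num.Theory.

Local Open Scope nat_scope.

Record hypergraph (r : nat) (V : finType) := Hypergraph {
  edges : {set {set V}};
  edges_uniform : forall e, e \in edges -> #|e| = r
}.

Definition isomorphic (r : nat) (V W : finType)
    (H : hypergraph r V) (K : hypergraph r W) : Prop :=
  exists2 f : V -> W, bijective f &
    forall e : {set V}, (e \in edges H) = (f @: e \in edges K).

Section Spectrum.
Variable R : realType.
Local Open Scope ring_scope.

(* The entry a_{i_1 i_2 ... i_r} is [a i_1 [tuple i_2; ...; i_r]]; indices are
   the vertices themselves, so no enumeration of the vertex set is chosen. *)
Definition tensor (r : nat) (V : finType) : Type := V -> r.-1.-tuple V -> R[i].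

Definition adjacency_tensor (r : nat) (V : finType) (H : hypergraph r V) :
    tensor r V :=
  fun i s => if [set j in i :: s] \in edges H then ((r.-1)`!%:R)^-1 else 0.

Definition tensor_eigenvalue (r : nat) (V : finType) (a : tensor r V)
    (lambda : R[i]) : Prop :=
  exists2 x : {ffun V -> R[i]}, x != 0 &
    forall i : V,
      \sum_(s : r.-1.-tuple V) a i s * \prod_(j <- s) x j
        = lambda * x i ^+ r.-1.

Local Open Scope classical_set_scope.

Definition eigenvalue_moduli (r : nat) (V : finType) (a : tensor r V) : set R :=
  [set ComplexField.Normc.normc lambda | lambda in tensor_eigenvalue a].

(* The greatest element of the set of moduli (0 if there were none). *)
Definition spectral_radius (r : nat) (V : finType) (H : hypergraph r V) : R :=
  let M := eigenvalue_moduli (adjacency_tensor H) in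
  xget 0 [set m | M m /\ ubound M m].

End Spectrum.

Definition blowup_vertex (t : nat) (ns : 'I_t -> nat) : finType :=
  {j : 'I_t & 'I_(ns j)}.

Section Blowup.
Variables (r t : nat) (G : hypergraph r 'I_t) (ns : 'I_t -> nat).

Definition blowup_edges : {set {set blowup_vertex ns}} :=
  [set [set u k | k : 'I_r] | u : {ffun 'I_r -> blowup_vertex ns}
     & [set tag (u k) | k : 'I_r] \in edges G].

Lemma blowup_uniform e : e \in blowup_edges -> #|e| = r.
Proof.
case/imsetP=> u; rewrite inE => /edges_uniform hu ->.
apply/eqP; rewrite eqn_leq; apply/andP; split.
  by apply: leq_trans (leq_imset_card _ _) _; rewrite card_ord.
rewrite -[X in X <= _]hu (_ : imset _ _ = tag @: [set u k | k : 'I_r]).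
  exact: leq_imset_card.
by rewrite -imset_comp.
Qed.

Definition blowup : hypergraph r (blowup_vertex ns) :=
  Hypergraph blowup_uniform.

End Blowup.

(* [H] belongs to B_n(G); hypergraphs are taken up to isomorphism. *)
Definition in_blowups (n r t : nat) (G : hypergraph r 'I_t)
    (V : finType) (H : hypergraph r V) : Prop :=
  exists ns : 'I_t -> nat,
    [/\ forall j, 0 < ns j, \sum_(j < t) ns j = n & isomorphic H (blowup G ns)].

Section Complete.
Variables r t : nat.

Definition complete_edges : {set {set 'I_t}} := [set e : {set 'I_t} | #|e| == r].

Lemma complete_uniform e : e \in complete_edges -> #|e| = r.
Proof. by rewrite inE => /eqP. Qed.

Definition complete_hypergraph : hypergraph r 'I_t :=
  Hypergraph complete_uniform.

End Complete.

Section Turan.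
Variables r t n : nat.

(* The residue classes modulo [t] are the parts: see [card_turan_part]. *)
Definition turan_part (j : 'I_t) : {set 'I_n} := [set v : 'I_n | v %% t == j].

Definition turan_edges : {set {set 'I_n}} :=
  [set e : {set 'I_n} | (#|e| == r) && [forall j, #|e :&: turan_part j| <= 1]].

Lemma turan_uniform e : e \in turan_edges -> #|e| = r.
Proof. by rewrite inE => /andP[/eqP]. Qed.

Definition turan_hypergraph : hypergraph r 'I_n := Hypergraph turan_uniform.

End Turan.

Lemma card_turan_part (t n : nat) (j : 'I_t) :
  #|turan_part n j| = n %/ t + (j < n %% t).
Proof.
have t0 : 0 < t by apply: leq_ltn_trans (ltn_ord j).
have -> : #|turan_part n j| = \sum_(0 <= v < n) (v %% t == j).
  by rewrite big_mkord -sum1_card big_mkcond; apply: eq_bigr => v _; rewrite inE.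
elim: n => [|n IH]; first by rewrite big_geq // div0n mod0n.
rewrite big_nat_recr //= {}IH divnS // modnS.
have hm : n %% t < t by rewrite ltn_mod.
have [td|td] := boolP (t %| n.+1).
- have := td; rewrite /dvdn -addn1 -modnDml addn1 => /eqP h.
  have -> : n %% t = t.-1.
    apply/eqP; rewrite eqn_leq -ltnS prednK // hm /= -ltnS prednK //.
    by rewrite leqNgt; apply/negP => h2; move: h; rewrite modn_small.
  have hj := ltn_ord j; case: eqP => ?; lia.
- by case: eqP => ?; lia.
Qed.

(* The sizes (n - t + 1, 1, ..., 1). *)
Definition star_sizes (n t : nat) : 'I_t -> nat :=
  fun j => if j == 0 :> nat then n - t + 1 else 1.

(* Main.v *)
(* The spectral radius of an r-uniform hypergraph is the maximum of
   r * sum_(e in E) prod_(v in e) x_v over nonnegative x with sum_v x_v^r = 1,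
   and a maximizer x is an eigenvector. For a complete t-partite hypergraph this
   form is r e_r(y_1, ..., y_t), where y_j is the sum of x over the j-th part, and
   the eigenvalue equations make x constant and positive on each part. If a part
   of size a and a part of size b satisfy a >= b + 2, moving a vertex of weight z
   from the first to the second while keeping x replaces (y_1, y_2) by
   (y_1 - z, y_2 + z). Since y_1 - z > y_2, this increases y_1 y_2 and hence the
   spectral radius strictly. So among the partitions into t nonempty parts a
   maximizer has balanced parts, and a minimizer at most one part of size > 1. *)
Require Import Defs.
From mathcomp Require Import all_boot all_order all_algebra.
From mathcomp Require Import perm complex.
From mathcomp Require Import boolp classical_sets reals.
From mathcomp Require Import topology normedtype realfun derive exp.
From mathcomp Require Import zify ring lra.
Import Order.TTheory GRing.Theory Num.Theory numFieldNormedType.Exports.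

Set Implicit Arguments.
Unset Strict Implicit.
Unset Printing Implicit Defensive.

(** * Complete multipartite hypergraphs up to isomorphism *)

Section Isomorphism.
Variable r : nat.

Lemma isomorphic_sym (V W : finType) (H : hypergraph r V) (K : hypergraph r W) :
  isomorphic H K -> isomorphic K H.
Proof.
case=> f [g fK gK] fE; exists g => [|e]; first by exists f.
rewrite fE -imset_comp (eq_imset (g := id)) ?imset_id //.
Qed.

Lemma isomorphic_trans (U V W : finType) (H : hypergraph r U)
    (K : hypergraph r V) (L : hypergraph r W) :
  isomorphic H K -> isomorphic K L -> isomorphic H L.
Proof.
case=> f fB fE [g gB gE]; exists (g \o f) => [|e]; first exact: bij_comp.
by rewrite fE gE -imset_comp.
Qed.

Lemma eq_edges_isomorphic (V : finType) (H K : hypergraph r V) :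
  edges H = edges K -> isomorphic H K.
Proof.
by move=> eHK; exists id => [|e]; [exists id | rewrite eHK imset_id].
Qed.

End Isomorphism.

(** Fibers over the same [c] have equal size, so the k-th element of one, in the order of [enum], is
    sent to the k-th element of the other. By [sz] and [sz'] the defaults of [nth] are never
    reached. *)
Lemma bijective_same_fibers (A B : finType) (T : eqType) (a : A -> T) (b : B -> T) :
    (forall c, #|[pred v | a v == c]| = #|[pred w | b w == c]|) ->
  exists2 f : A -> B, bijective f & forall v, b (f v) = a v.
Proof.
move=> ab.
have inh (w : B) : exists v, a v == b w.
  by apply/card_gt0P; rewrite (ab (b w)); apply/card_gt0P; exists w; rewrite inE.
have inh' (v : A) : exists w, b w == a v.
  by apply/card_gt0P; rewrite -(ab (a v)); apply/card_gt0P; exists v; rewrite inE.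
pose f v := nth (xchoose (inh' v)) (enum [pred u | b u == a v])
                (index v (enum [pred u | a u == a v])).
pose g w := nth (xchoose (inh w)) (enum [pred u | a u == b w])
                (index w (enum [pred u | b u == b w])).
have sz v : index v (enum [pred u | a u == a v]) < size (enum [pred u | b u == a v]).
  by rewrite -cardE -ab cardE index_mem mem_enum inE.
have sz' w : index w (enum [pred u | b u == b w]) < size (enum [pred u | a u == b w]).
  by rewrite -cardE ab cardE index_mem mem_enum inE.
have bf v : b (f v) = a v.
  by apply/eqP; have := mem_nth (xchoose (inh' v)) (sz v); rewrite mem_enum inE.
have ag w : a (g w) = b w.
  by apply/eqP; have := mem_nth (xchoose (inh w)) (sz' w); rewrite mem_enum inE.
exists f => //; exists g => [v|w].
  rewrite /g (set_nth_default v) ?sz' // bf.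
  by rewrite index_uniq ?enum_uniq // nth_index // mem_enum inE.
rewrite /f (set_nth_default w) ?sz // ag.
by rewrite index_uniq ?enum_uniq // nth_index // mem_enum inE.
Qed.

Section Multipartite.
Variables (r t : nat) (V : finType).
Implicit Type p : V -> 'I_t.

(** The equality of cardinals encodes injectivity of [p] on [e]: at most one vertex from each
    part. *)
Definition multipartite_edges p : {set {set V}} :=
  [set e : {set V} | (#|e| == r) && (#|p @: e| == #|e|)].

Lemma multipartite_uniform p e : e \in multipartite_edges p -> #|e| = r.
Proof. by rewrite inE => /andP[/eqP]. Qed.

Definition multipartite p : hypergraph r V :=
  Hypergraph (@multipartite_uniform p).

Definition part_size p (j : 'I_t) : nat := #|[pred v | p v == j]|.

Lemma sum_part_size p : \sum_j part_size p j = #|V|.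
Proof.
rewrite -sum1_card (partition_big p predT) //=.
by apply: eq_bigr => j _; rewrite sum1_card.
Qed.

End Multipartite.

Lemma multipartite_isomorphic (r t : nat) (V W : finType) (p : V -> 'I_t)
    (q : W -> 'I_t) (s : 'I_t -> 'I_t) :
    bijective s -> (forall j, part_size p j = part_size q (s j)) ->
  isomorphic (multipartite r p) (multipartite r q).
Proof.
move=> sB pq; have [s' sK s'K] := sB.
have [c|f fB fE] := @bijective_same_fibers V W _ (s \o p) q.
  rewrite -{2}(s'K c) -[RHS]pq; apply: eq_card => v.
  by rewrite !inE /= (can2_eq sK s'K).
exists f => // e; rewrite !inE (card_imset _ (bij_inj fB)) -imset_comp.
by rewrite (eq_imset e fE) (imset_comp s p) (card_imset _ (bij_inj sB)).
Qed.

Lemma isomorphic_blowup_complete (r t : nat) (ns : 'I_t -> nat) :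
  isomorphic (blowup (complete_hypergraph r t) ns)
    (multipartite r (fun v : blowup_vertex ns => tag v)).
Proof.
apply: eq_edges_isomorphic; apply/setP=> e; apply/idP/idP => [|]; last first.
  rewrite inE => /andP[/eqP er /eqP pe]; apply/imsetP.
  have u k : k < r -> k < size (enum e) by rewrite -cardE er.
  (* An edge of the blow-up must be presented as the image of a map from ['I_r]; [w] enumerates
     [e]. *)
  pose w := [ffun k : 'I_r => tnth (in_tuple (enum e)) (Ordinal (u k (ltn_ord k)))].
  have ew : e = [set w k | k : 'I_r].
    apply/setP=> v; apply/idP/imsetP=> [ve|[k _ ->]].
      have vi : index v (enum e) < r by rewrite -er cardE index_mem mem_enum.
      exists (Ordinal vi) => //; rewrite ffunE (tnth_nth v) /= nth_index //.
      by rewrite mem_enum.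
    by rewrite ffunE -mem_enum; apply: mem_tnth.
  exists w => //; rewrite !inE.
  rewrite (_ : imset _ _ = (fun v => tag v) @: e) ?pe ?er //.
  by rewrite ew -imset_comp.
move=> eE; have er := blowup_uniform eE; move: eE.
case/imsetP=> u; rewrite inE /= inE => /eqP hu eu.
rewrite inE er eqxx /= -hu eu; apply/eqP; congr #|pred_of_set _|.
by rewrite -imset_comp.
Qed.

Lemma part_size_tag (t : nat) (ns : 'I_t -> nat) j :
  part_size (fun v : blowup_vertex ns => tag v) j = ns j.
Proof.
have inj : injective (Tagged (fun j => 'I_(ns j)) (i := j)).
  by move=> k l /eqP; rewrite eq_Tagged => /eqP.
rewrite -[RHS]card_ord -(card_imset _ inj).
apply: eq_card => v; rewrite !inE; apply/eqP/imsetP => [|[k _ ->] //].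
by case: v => /= i k ij; move: k; rewrite ij => k; exists k.
Qed.

Lemma isomorphic_turan (r t n : nat) (t0 : 0 < t) :
  isomorphic (turan_hypergraph r t n)
    (multipartite r (fun v : 'I_n => Ordinal (ltn_pmod v t0))).
Proof.
apply: eq_edges_isomorphic; apply/setP=> e; rewrite !inE; congr (_ && _).
apply/forallP/eqP => [h|/eqP/imset_injP h j].
  apply/eqP/imset_injP => v w ve we [vw].
  have := h (Ordinal (ltn_pmod v t0)); move/card_le1_eqP; apply; rewrite inE ?ve ?we.
    by rewrite inE /= vw.
  by rewrite inE /=.
apply/card_le1_eqP => v w; rewrite !inE => /andP[ve /eqP vj] /andP[we /eqP wj].
by apply: h => //; apply: val_inj; rewrite /= vj wj.
Qed.

Lemma part_size_turan (t n : nat) (t0 : 0 < t) j :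
  part_size (fun v : 'I_n => Ordinal (ltn_pmod v t0)) j = n %/ t + (j < n %% t).
Proof.
by rewrite -card_turan_part; apply: eq_card => v; rewrite !inE.
Qed.

(** The only possible values are the minimum [q] and [q.+1]. If [q.+1] occurs [m] times, then
    [n = q * #|I| + m] with [m < #|I|], so Euclidean division recovers [q] and [m]: balanced sizes
    are determined up to order. *)
Lemma balanced_fiber_card (I : finType) (a : I -> nat) :
    0 < #|I| -> (forall i j, a i <= (a j).+1) ->
  let n := \sum_i a i in forall c,
  #|[pred i | a i == c]| =
    if c == n %/ #|I| then #|I| - n %% #|I|
    else if c == (n %/ #|I|).+1 then n %% #|I| else 0.
Proof.
move=> /card_gt0P[i0 _] bal n.
case: (arg_minnP a (erefl (predT i0))) => j0 _ min0; set q := a j0.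
pose m := #|[pred i | a i == q.+1]|.
have aq i : q <= a i <= q.+1 by rewrite bal min0.
have nE : n = q * #|I| + m.
  rewrite mulnC -sum_nat_const /m -sum1_card [X in _ + X]big_mkcond -big_split /=.
  by apply: eq_bigr => i _; rewrite inE; have := aq i; case: eqP; lia.
have mI : m + #|[pred i | a i == q]| = #|I|.
  rewrite -(cardC [pred i | a i == q.+1]); congr (_ + _); apply: eq_card => i.
  by rewrite !inE; have := aq i; lia.
have q0 : 0 < #|[pred i | a i == q]| by apply/card_gt0P; exists j0; rewrite inE.
have mlt : m < #|I| by lia.
rewrite nE divnMDl ?modnMDl ?(leq_ltn_trans _ mlt) // divn_small // modn_small //.
rewrite addn0 => c; have [->|cq] := eqVneq c q; first by lia.
have [->//|cq1] := eqVneq c q.+1.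
by apply: eq_card0 => i; rewrite !inE; have := aq i; lia.
Qed.

Lemma balanced_isomorphic_turan (r t : nat) (V : finType) (p : V -> 'I_t) :
    0 < t -> (forall i j, part_size p i <= (part_size p j).+1) ->
  isomorphic (multipartite r p) (turan_hypergraph r t #|V|).
Proof.
move=> t0 bal; set n := #|V|.
apply: isomorphic_trans (isomorphic_sym (isomorphic_turan r n t0)).
set q := fun v : 'I_n => _.
(* The fiber lemma is applied to the part indices themselves, which matches parts of equal size. *)
have [c|s sB sE] := @bijective_same_fibers _ _ _ (part_size p) (part_size q).
  rewrite !balanced_fiber_card ?card_ord // ?sum_part_size ?card_ord //.
  by move=> i j; rewrite !part_size_turan; case: (_ < _); case: (_ < _); lia.
exact: multipartite_isomorphic sB _.
Qed.

Lemma part_size_star (n t : nat) (j0 : 'I_t) (a : 'I_t -> nat) :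
    (forall j, j != j0 -> a j = 1) -> 0 < a j0 -> \sum_j a j = n ->
  a j0 = n - t + 1.
Proof.
move=> a1 a0 <-; rewrite (bigD1 j0) //= (eq_bigr (fun=> 1)) => [|j]; last exact: a1.
rewrite sum1_card; have := cardC1 j0; rewrite card_ord.
rewrite (eq_card (B := predC1 j0)) => [|j]; last by rewrite !inE.
move=> ->; have := ltn_ord j0; lia.
Qed.

Lemma star_isomorphic (r t : nat) (V : finType) (p : V -> 'I_t) (j0 : 'I_t) :
    (forall j, j != j0 -> part_size p j = 1) ->
    0 < part_size p j0 ->
  isomorphic (multipartite r p)
    (blowup (complete_hypergraph r t) (@star_sizes #|V| t)).
Proof.
move=> p1 p0; apply: isomorphic_trans (isomorphic_sym (isomorphic_blowup_complete _ _)).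
have t0 : 0 < t by apply: leq_ltn_trans (ltn_ord j0).
have pj0 : part_size p j0 = #|V| - t + 1.
  by apply: part_size_star => //; exact: sum_part_size.
pose i0 := Ordinal t0.
(* The transposition brings the exceptional part [j0] to index 0, where [star_sizes] has it. *)
apply: (@multipartite_isomorphic _ _ _ _ _ _ (tperm j0 i0)) => [|j].
  by exists (tperm j0 i0); exact: tpermK.
rewrite part_size_tag /star_sizes -[_ == 0 :> nat]/(tperm j0 i0 j == i0).
rewrite -[X in _ == X](tpermL j0 i0) (inj_eq perm_inj).
by case: eqVneq => [->|/p1].
Qed.

Local Open Scope ring_scope.

(** * The spectral radius as a constrained maximum *)

Section EdgeSums.
Variables (r : nat) (V : finType) (H : hypergraph r V).

Definition edge_sum (F : comPzRingType) (x : V -> F) : F :=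
  \sum_(e in edges H) \prod_(v in e) x v.

(** The partial derivative of [edge_sum] in the variable at [i]; by [adjacency_tensor_sum] it is
    also the left side of the eigenvalue equation. *)
Definition link_sum (F : comPzRingType) (x : V -> F) (i : V) : F :=
  \sum_(e in edges H | i \in e) \prod_(v in e :\ i) x v.

(** Euler's identity for a form of degree [r]: each edge monomial is counted once for each of its
    [r] vertices. *)
Lemma euler_edge_sum (F : comPzRingType) (x : V -> F) :
  \sum_i x i * link_sum x i = edge_sum x *+ r.
Proof.
transitivity (\sum_i \sum_(e in edges H | i \in e) \prod_(v in e) x v).
  apply: eq_bigr => i _; rewrite mulr_sumr; apply: eq_bigr => e /andP[_ ie].
  by rewrite [RHS](big_setD1 i).
rewrite (exchange_big_dep (fun e => e \in edges H)) /=; last by move=> ? ? _ /andP[].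
rewrite -sumrMnl; apply: eq_bigr => e eH.
rewrite -[X in _ *+ X](edges_uniform eH) -sumr_const; apply: eq_bigl => i.
by rewrite eH.
Qed.

(** An edge contains a vertex at most once, so the form is affine in each single variable. *)
Lemma edge_sum_shift (F : comPzRingType) (x : V -> F) (i : V) (d : F) :
  edge_sum (fun v => if v == i then x v + d else x v)
    = edge_sum x + d * link_sum x i.
Proof.
rewrite /edge_sum (bigID (fun e : {set V} => i \in e)) /=.
rewrite [in RHS](bigID (fun e : {set V} => i \in e)) /= addrAC; congr (_ + _).
  rewrite mulr_sumr -big_split /=; apply: eq_bigr => e /andP[_ ie].
  rewrite (big_setD1 i) //= [X in _ = X + _](big_setD1 i) //= eqxx mulrDl.
  congr (_ * _ + _ * _); apply: eq_bigr => v; rewrite !inE => /andP[/negPf ->] //.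
apply: eq_bigr => e /andP[_ ie]; apply: eq_bigr => v ve.
by case: eqP => // vi; rewrite -vi ve in ie.
Qed.

Lemma rmorph_link_sum (F K : comPzRingType) (f : {rmorphism F -> K}) (x : V -> F) i :
  f (link_sum x i) = link_sum (f \o x) i.
Proof. by rewrite rmorph_sum; apply: eq_bigr => e _; rewrite rmorph_prod. Qed.

Lemma edge_sumZ (F : comPzRingType) (x : V -> F) (c : F) :
  edge_sum (fun v => c * x v) = c ^+ r * edge_sum x.
Proof.
rewrite mulr_sumr; apply: eq_bigr => e eH.
by rewrite big_split prodr_const (edges_uniform eH).
Qed.

Lemma edge_sum_ge0 (F : numDomainType) (x : V -> F) :
  (forall v, 0 <= x v) -> 0 <= edge_sum x.
Proof. by move=> x0; apply: sumr_ge0 => e _; apply: prodr_ge0. Qed.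

Lemma link_sum_ge0 (F : numDomainType) (x : V -> F) i :
  (forall v, 0 <= x v) -> 0 <= link_sum x i.
Proof. by move=> x0; apply: sumr_ge0 => e _; apply: prodr_ge0. Qed.

(* Each edge through [i] is listed by [(r-1)!] tuples, which cancels the entry
   [1/(r-1)!] of the tensor. *)
Lemma adjacency_tensor_sum (R : realType) (x : V -> R[i]) (i : V) :
  \sum_(s : r.-1.-tuple V) adjacency_tensor R H i s * \prod_(j <- s) x j
    = link_sum x i.
Proof.
rewrite /link_sum; transitivity (\sum_(s : r.-1.-tuple V |
    [set j in i :: s] \in edges H) (r.-1`!%:R)^-1 * \prod_(j <- s) x j).
  rewrite [RHS]big_mkcond; apply: eq_bigr => s _; rewrite /adjacency_tensor.
  by case: ifP => // _; rewrite mul0r.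
rewrite (partition_big (fun s : r.-1.-tuple V => [set j in i :: s])
  (fun e : {set V} => (e \in edges H) && (i \in e))) /=; last first.
  by move=> s ->; rewrite !inE eqxx.
apply: eq_bigr => e /andP[eH ie].
have er := edges_uniform eH.
have er1 : #|e :\ i| = r.-1 by rewrite -er (cardsD1 i e) ie.
have r0 : (0 < r)%N by rewrite -er; apply/card_gt0P; exists i.
(* Since [i :: s] has [r] entries, it covers the [r]-set [e] only if [s] lists [e :\ i] without
   repetition. *)
have sE (s : r.-1.-tuple V) : ([set j in i :: s] \in edges H) &&
    ([set j in i :: s] == e) = all (mem (e :\ i)) s && uniq s.
  apply/andP/andP => [[_ /eqP se]|[/allP sA us]].
    have /andP[iNs us] : uniq (i :: s).
      by apply/card_uniqP; rewrite -cardsE se er /= size_tuple prednK.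
    split=> //; apply/allP => j js; rewrite !inE -se !inE js orbT andbT.
    by apply: contraNneq iNs => <-.
  have iNs : i \notin s by apply/negP => /sA; rewrite !inE eqxx.
  suff se : [set j in i :: s] = e by rewrite se eH.
  apply/eqP; rewrite eqEcard cardsE er (card_uniqP _) /= ?iNs // size_tuple.
  rewrite prednK // leqnn andbT; apply/fintype.subsetP=> j; rewrite !inE.
  by case/orP=> [/eqP->//|/sA]; rewrite !inE => /andP[].
rewrite (eq_bigl _ _ sE).
rewrite (eq_bigr (fun=> (r.-1`!%:R)^-1 * \prod_(v in e :\ i) x v)); last first.
  move=> s /[dup] sA /andP[_ us]; congr (_ * _); rewrite big_uniq //=.
  apply: eq_bigl => j; move: (sA); rewrite -sE => /andP[_ /eqP eE].
  have iNs : i \notin s.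
    by apply/negP; move: sA => /andP[/allP/(_ i)] + _ => /[apply]; rewrite !inE eqxx.
  by rewrite inE -eE !inE; case: eqP => //= ->; exact: negPf.
rewrite sumr_const -[X in _ *+ X](cardsE) card_uniq_tuples er1 ffactnn.
by rewrite -[LHS]mulr_natl mulrA divff ?mul1r // pnatr_eq0 -lt0n fact_gt0.
Qed.

End EdgeSums.

Section Perron.
Variables (R : realType) (r : nat) (V : finType) (H : hypergraph r V).
Hypothesis r2 : (2 <= r)%N.
Implicit Types x z : V -> R.

(** The vector [x] shows that [rho] is an eigenvalue. For any eigenvalue [lambda] with eigenvector
    [y], put [z = |y|]: the triangle inequality bounds [|lambda| * z i ^+ r.-1] by the link sum of
    [z], and multiplying by [z i], summing with Euler's identity and applying the last hypothesis
    gives [|lambda| <= rho]. *)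
Lemma spectral_radiusP (rho : R) x :
    (forall v, 0 <= x v) -> (exists v, x v != 0) ->
    (forall i, link_sum H x i = rho * x i ^+ r.-1) ->
    (forall z, (forall v, 0 <= z v) -> edge_sum H z *+ r <= rho * \sum_v z v ^+ r) ->
  spectral_radius R H = rho.
Proof.
move=> x0 [v0 xv0] xE ub.
have SrE z i : z i ^+ r = z i * z i ^+ r.-1 by rewrite -exprS prednK // (ltn_trans _ r2).
have rho0 : 0 <= rho.
  have xr : 0 < x v0 ^+ r by rewrite exprn_gt0 // lt_def xv0 x0.
  have sx : 0 < \sum_v x v ^+ r.
    rewrite (bigD1 v0) //= ltr_pwDl // sumr_ge0 // => v _.
    exact: exprn_ge0.
  rewrite -(pmulr_lge0 _ sx); apply: le_trans (ub _ x0).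
  by rewrite mulrn_wge0 // edge_sum_ge0.
rewrite /spectral_radius; set M := eigenvalue_moduli _.
have Mrho : M rho.
  exists (rho%:C)%C; last first.
    by rewrite /= expr0n /= addr0 sqrtr_sqr ger0_norm.
  exists [ffun v => (x v)%:C%C].
    apply/eqP => /ffunP/(_ v0); rewrite !ffunE => /complexI/eqP.
    exact/negP.
  move=> i; rewrite adjacency_tensor_sum ffunE -rmorphXn -rmorphM -xE.
  rewrite rmorph_link_sum; apply: eq_bigr => e _; apply: eq_bigr => v _.
  by rewrite ffunE.
have Mub : ubound M rho.
  move=> _ [lambda [y y0 yE] <-].
  pose z v := ComplexField.Normc.normc (y v).
  have zE v : `|y v| = (z v)%:C%C by [].
  have z0 v : 0 <= z v by rewrite /z; case: (y v) => a b; exact: sqrtr_ge0.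
  have [w yw] : exists w, y w != 0.
    apply/existsP; apply: contraNT y0; rewrite negb_exists => /forallP y0.
    by apply/eqP/ffunP => v; rewrite ffunE; apply/eqP; rewrite -[_ == _]negbK.
  have sz : 0 < \sum_v z v ^+ r.
    rewrite (bigD1 w) //= ltr_pwDl ?sumr_ge0 // => [|v _]; last exact: exprn_ge0.
    apply: exprn_gt0; rewrite lt_def z0 andbT; apply: contra yw => /eqP zw.
    by rewrite -normr_eq0 zE zw.
  rewrite -(ler_pM2r sz); apply: le_trans (ub _ z0).
  rewrite -euler_edge_sum mulr_sumr; apply: ler_sum => i _.
  rewrite SrE mulrCA ler_wpM2l // -lecR !rmorphM rmorphXn rmorph_link_sum.
  rewrite -[X in X * _]/(`|lambda|) -[X in _ * X ^+ _]/(`|y i|) -normrX -normrM.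
  rewrite -yE adjacency_tensor_sum; apply: le_trans (ler_norm_sum _ _ _) _.
  by apply: ler_sum => e _; rewrite normr_prod.
by apply: xget_unique => // m [Mm mub]; apply/eqP; rewrite eq_le Mub ?mub.
Qed.

Lemma exists_root (a : R) : 0 <= a -> exists2 b, 0 <= b & b ^+ r = a.
Proof.
move=> a0; exists (a `^ r%:R^-1); first exact: powR_ge0.
rewrite -powR_mulrn ?powR_ge0 // -powRrM mulVf ?powRr1 //.
by rewrite pnatr_eq0 -lt0n (ltn_trans _ r2).
Qed.

(** The extreme value theorem on the compact set [K] yields [x]; homogeneity of degree [r] extends
    the bound to all nonnegative [z]. *)
Lemma edge_sum_maximizer : (0 < #|V|)%N ->
  exists x, [/\ forall v, 0 <= x v, \sum_v x v ^+ r = 1 &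
    forall z, (forall v, 0 <= z v) ->
      edge_sum H z <= edge_sum H x * \sum_v z v ^+ r].
Proof.
move=> /card_gt0P[v0 _].
have r0 : (0 < r)%N by exact: ltn_trans r2.
pose T := prod_topology (fun _ : V => R).
pose nrm (f : T) : R := \sum_v f v ^+ r.
pose es (f : T) : R := edge_sum H f.
have addc : continuous (fun z : R * R => z.1 + z.2) by exact: add_continuous.
have mulc : continuous (fun z : R * R => z.1 * z.2) by exact: mul_continuous.
have prc v : continuous (fun f : T => f v) by exact: proj_continuous.
have nrmc : continuous nrm.
  apply: continuous_big => // v _ f.
  apply: (@continuous_comp _ _ _ _ (fun y : R => y ^+ r)); first exact: prc.
  exact: exprn_continuous.
have esc : continuous es.
  by apply: continuous_big => // e _; apply: continuous_big => // v _.
(* The cube is compact by Tychonoff. The bound 1 loses nothing: nonnegative coordinates whose [r]-th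
   powers sum to 1 are at most 1. *)
pose cube : classical_sets.set T := [set f : T | forall v, `[0, 1]%classic (f v)]%classic.
pose K : classical_sets.set T := (cube `&` nrm @^-1` [set 1])%classic.
have cK : compact K.
  apply: compact_closedI.
    apply: (@tychonoff V (fun=> R) (fun=> `[0, 1]%classic)) => v.
    exact: segment_compact.
  by apply: preimage_closed; [move=> f _; exact: nrmc|exact: closed_eq].
have K0 : (K !=set0)%classic.
  exists (fun v => (v == v0)%:R); split.
    by move=> v /=; rewrite in_itv /=; case: (_ == _); rewrite ?lexx ?ler01.
  rewrite /nrm /= (bigD1 v0) //= eqxx expr1n big1 ?addr0 // => v /negPf ->.
  by rewrite expr0n; case: (r) r0.
have [x xK xmax] := compact_EVT_max K0 cK (continuous_subspaceT esc).
move: xK; rewrite inE => -[xc x1].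
have xnn v : 0 <= x v by have := xc v; rewrite /= in_itv => /andP[].
exists x; split=> // z z0.
have s0 : 0 <= \sum_v z v ^+ r by apply: sumr_ge0 => v _; exact: exprn_ge0.
have [b b0 bE] := exists_root s0.
(* If [b = 0], then [z] vanishes and cannot be normalized, but both sides are 0. *)
have [b00|bN0] := eqVneq b 0.
  have z00 v : z v = 0.
    move: bE; rewrite b00 expr0n gtn_eqF // => /esym/eqP.
    rewrite psumr_eq0 => [|w _]; last exact: exprn_ge0.
    by move=> /allP/(_ v (mem_index_enum _))/=; rewrite expf_eq0 r0 => /eqP.
  have -> : edge_sum H z = 0 ^+ r * edge_sum H x.
    rewrite -edge_sumZ; apply: eq_bigr => e _; apply: eq_bigr => v _.
    by rewrite mul0r z00.
  by rewrite -bE b00 mulrC.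
have bgt : 0 < b by rewrite lt_def bN0.
pose y v := b^-1 * z v.
have y0 v : 0 <= y v by rewrite mulr_ge0 // invr_ge0.
have ys : nrm y = 1.
  rewrite /nrm /y; under eq_bigr do rewrite exprMn.
  by rewrite -mulr_sumr -bE -exprMn mulVf // expr1n.
have yK : y \in K.
  rewrite inE; split=> // v /=; rewrite in_itv /= y0 /=.
  rewrite -(ler_pXn2r r0) ?nnegrE ?ler01 // expr1n -ys /nrm (bigD1 v) //= lerDl.
  by apply: sumr_ge0 => w _; exact: exprn_ge0.
have := xmax _ yK; rewrite /es /y edge_sumZ -bE exprVn mulrC.
by rewrite ler_pdivrMr // exprn_gt0.
Qed.

(** The first-order condition in one coordinate. Shifting [x i] by [d] changes the form by [d * L]
    and the bound by [d * h.[d]], so [d * L <= d * h.[d]]; letting [d] tend to 0 from the right and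
    from the left gives both inequalities. *)
Lemma maximizer_eigenvector (m : R) x :
    (forall v, 0 <= x v) -> edge_sum H x = m * \sum_v x v ^+ r ->
    (forall z, (forall v, 0 <= z v) -> edge_sum H z <= m * \sum_v z v ^+ r) ->
  forall i, link_sum H x i = (m *+ r) * x i ^+ r.-1.
Proof.
move=> x0 xE ub i; set c := x i; set L := link_sum H x i.
(* The difference quotient of [m * (c + d) ^+ r] at [d = 0], written as a polynomial in [d], so that
   its limit at 0 is a value. *)
pose h := m *: \sum_(k < r) (c%:P + 'X) ^+ (r.-1 - k) * (c ^+ k)%:P.
have hE d : h.[d] = m * \sum_(k < r) (c + d) ^+ (r.-1 - k) * c ^+ k.
  by rewrite hornerZ horner_sum; congr (_ * _); apply: eq_bigr => k _; rewrite !hornerE.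
have h0 : h.[0] = (m *+ r) * c ^+ r.-1.
  rewrite hE addr0 (eq_bigr (fun=> c ^+ r.-1)) => [|k _]; last first.
    by rewrite -exprD subnK // -ltnS prednK // (ltn_trans _ r2).
  by rewrite sumr_const card_ord mulrnAr mulrnAl.
have hc : {for 0, continuous (horner h)} by exact: continuous_horner.
have Lh d : 0 <= c + d -> d * L <= d * h.[d].
  move=> cd; pose z v := if v == i then x v + d else x v.
  have z0 v : 0 <= z v by rewrite /z; case: eqP => [->|_].
  have := ub z z0; rewrite edge_sum_shift xE (bigD1 i) //= [X in _ <= _ * X](bigD1 i) //=.
  rewrite /z eqxx [X in _ <= _ * (_ + X)](eq_bigr (fun v => x v ^+ r)); last first.
    by move=> v /negPf ->.
  rewrite !mulrDr addrAC lerD2r -/c -/L -lerBrDl -mulrBr => /le_trans; apply.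
  by rewrite hE mulrCA subrXX [c + d - c]addrAC subrr add0r.
rewrite -h0; apply/eqP; rewrite eq_le; apply/andP; split.
  apply: (cvgr_to_ge (cvg_at_right_filter hc)); near=> d.
  have d0 : 0 < d by near: d; exact: nbhs_right_gt.
  by rewrite -(ler_pM2l d0) Lh // addr_ge0 ?x0 // ltW.
(* At [c = 0] no negative shift is admissible; there [h.[0] = 0] because [r.-1 > 0], and the link
   sum is nonnegative. *)
have [c0|cN0] := eqVneq c 0.
  rewrite h0 c0 expr0n; case: (r) r2 => [|[|k]] //= _.
  by rewrite mulr0 link_sum_ge0.
have cgt : 0 < c by rewrite lt_def cN0 x0.
apply: (cvgr_to_le (cvg_at_left_filter hc)); near=> d.
have d0 : d < 0 by near: d; exact: nbhs_left_lt.
have dc : - c < d by near: d; apply: nbhs_left_gt; rewrite oppr_lt0.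
by rewrite -(ler_nM2l d0) Lh // -lerBlDl sub0r ltW.
Unshelve. all: by end_near. Qed.

Lemma spectral_radius_eigenvector : (0 < #|V|)%N ->
  exists x, [/\ forall v, 0 <= x v, 0 < \sum_v x v ^+ r,
    forall i, link_sum H x i = spectral_radius R H * x i ^+ r.-1 &
    forall z, (forall v, 0 <= z v) ->
      edge_sum H z *+ r <= spectral_radius R H * \sum_v z v ^+ r].
Proof.
move=> V0; have [x [x0 x1 xmax]] := edge_sum_maximizer V0.
have xE : edge_sum H x = edge_sum H x * \sum_v x v ^+ r by rewrite x1 mulr1.
have xeig := maximizer_eigenvector x0 xE xmax.
have ub z : (forall v, 0 <= z v) ->
    edge_sum H z *+ r <= edge_sum H x *+ r * \sum_v z v ^+ r.
  by move=> /xmax; rewrite mulrnAl lerMn2r => ->; rewrite orbT.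
have xN0 : exists v, x v != 0.
  apply/existsP; apply: contra_eqT x1; rewrite negb_exists => /forallP x00.
  rewrite big1 ?(eq_sym 0) ?oner_eq0 // => v _; have := x00 v; rewrite negbK => /eqP ->.
  by rewrite expr0n; case: (r) r2.
exists x; rewrite x1 ltr01 (spectral_radiusP x0 xN0 xeig ub); split=> //.
Qed.

End Perron.

(** * Moving a vertex to another part *)

Lemma edge_sum_isomorphic (r : nat) (V W : finType) (H : hypergraph r V)
    (K : hypergraph r W) (F : comPzRingType) (f : V -> W) (z : W -> F) :
    bijective f -> (forall e : {set V}, (e \in edges H) = (f @: e \in edges K)) ->
  edge_sum K z = edge_sum H (z \o f).
Proof.
move=> fB fE; have [g fK gK] := fB.
rewrite /edge_sum (reindex (fun e : {set V} => f @: e)) /=; last first.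
  exists (fun e : {set W} => g @: e) => e _; rewrite -imset_comp.
    by rewrite (eq_imset (g := id) _ fK) imset_id.
  by rewrite (eq_imset (g := id) _ gK) imset_id.
rewrite (eq_bigl (fun e => e \in edges H)) => [|e]; last by rewrite fE.
by apply: eq_bigr => e _; rewrite big_imset //; exact: in2W (bij_inj fB).
Qed.

(** A nonnegative eigenvector of [H], transported along the inverse bijection, is a trial vector in
    the variational bound for [K]. *)
Lemma isomorphic_spectral_radius_le (R : realType) (r : nat) (V W : finType)
    (H : hypergraph r V) (K : hypergraph r W) :
    (2 <= r)%N -> (0 < #|V|)%N -> isomorphic H K ->
  spectral_radius R H <= spectral_radius R K.
Proof.
move=> r2 V0 [f fB fE]; have [g fK gK] := fB.
have W0 : (0 < #|W|)%N by rewrite -(bij_eq_card fB).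
have [x [x0 sx xE _]] := spectral_radius_eigenvector R H r2 V0.
have [_ [_ _ _ ub]] := spectral_radius_eigenvector R K r2 W0.
have SrE (y : R) : y ^+ r = y * y ^+ r.-1 by rewrite -exprS prednK // (ltn_trans _ r2).
rewrite -(ler_pM2r sx); have := ub (x \o g) (fun w => x0 (g w)).
rewrite (reindex f) /=; last exact: onW_bij.
rewrite (edge_sum_isomorphic _ fB fE) (eq_bigr (fun v => x v ^+ r)) => [|v _]; last first.
  by rewrite fK.
apply: le_trans; rewrite (_ : edge_sum H _ = edge_sum H x); last first.
  by apply: eq_bigr => e _; apply: eq_bigr => v _ /=; rewrite fK.
rewrite -euler_edge_sum mulr_sumr; apply: ler_sum => i _.
by rewrite xE mulrCA -SrE.
Qed.

Lemma isomorphic_spectral_radius (R : realType) (r : nat) (V W : finType)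
    (H : hypergraph r V) (K : hypergraph r W) :
    (2 <= r)%N -> (0 < #|V|)%N -> isomorphic H K ->
  spectral_radius R H = spectral_radius R K.
Proof.
move=> r2 V0 HK; have [f fB _] := HK.
apply/eqP; rewrite eq_le !isomorphic_spectral_radius_le -?(bij_eq_card fB) //.
exact: isomorphic_sym.
Qed.

(** * Part sums and elementary symmetric polynomials *)

Section PartSum.
Variables (V : finType) (t : nat) (M : nmodType) (x : V -> M).
Implicit Type p : V -> 'I_t.

(** An [nmodType] of values serves both real weights and, with the constant 1 in [nat], part
    sizes. *)
Definition part_sum p (j : 'I_t) : M := \sum_(v | p v == j) x v.

Definition reassign p (v : V) (j : 'I_t) : V -> 'I_t :=
  fun u => if u == v then j else p u.

Lemma part_sum_reassign p v i j : j != p v ->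
  part_sum (reassign p v j) i + x v *+ (i == p v)
    = part_sum p i + x v *+ (i == j).
Proof.
move=> jpv; rewrite /part_sum !(big_mkcond (fun v => _ v == i)) /=.
rewrite (bigD1 v) //= [in RHS](bigD1 v) //= /reassign eqxx.
rewrite (eq_bigr (fun u => if p u == i then x u else 0)) => [|u /negPf -> //].
have [->|iv] := eqVneq i (p v).
  by rewrite (negPf jpv) (eq_sym (p v)) (negPf jpv) mulr1n mulr0n add0r addr0 addrC.
rewrite (eq_sym j) mulr0n addr0.
by case: (i == j); rewrite ?mulr0n ?mulr1n add0r ?addr0 // addrC.
Qed.

End PartSum.

Lemma part_sizeE (V : finType) (t : nat) (p : V -> 'I_t) j :
  part_size p j = part_sum (fun=> 1%N) p j.
Proof. by rewrite /part_size -sum1_card. Qed.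

Lemma part_size_reassign (V : finType) (t : nat) (p : V -> 'I_t) v i j :
    j != p v ->
  (part_size (reassign p v j) i + (i == p v) = part_size p i + (i == j))%N.
Proof.
move=> /(part_sum_reassign (fun=> 1%N) i).
by rewrite !part_sizeE !natn.
Qed.

(** Expanding the product means choosing, for each part, either 1 or one of its vertices; such
    choices correspond to the sets on which [p] is injective. *)
Lemma prod_transversal (F : comPzRingType) (V : finType) (t : nat)
    (p : V -> 'I_t) (z : V -> F) :
  \prod_j (1 + part_sum z p j)
    = \sum_(e : {set V} | #|p @: e| == #|e|) \prod_(v in e) z v.
Proof.
pose ok j (o : option V) := oapp (fun v => p v == j) true o.
transitivity (\prod_j \sum_(o : option V | ok j o) oapp z 1 o).
  apply: eq_bigr => j _; rewrite (bigD1 None) //=; congr (_ + _).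
  rewrite (reindex_omap Some id) => [|[]//].
  by apply: eq_bigl => v; rewrite /= eqxx !andbT.
rewrite bigA_distr_big_dep /=.
(* [T] collects the chosen vertices and [C] recovers the choice from a set; [None] is the choice of
   1. The sets with [T (C e) = e] are the transversal ones. *)
pose T (c : {ffun 'I_t -> option V}) := [set v | c (p v) == Some v].
pose C (e : {set V}) := [ffun j => [pick v in e | p v == j]].
have okC e j : ok j (C e j).
  by rewrite ffunE; case: pickP => [v /andP[]|].
rewrite (reindex_onto C T) /=; last first.
  move=> c /familyP cok; apply/ffunP=> j; rewrite ffunE.
  have := cok j; rewrite unfold_in /ok.
  case E: (c j) => [v|] /=.
    move/eqP=> pv; case: pickP => [w|/(_ v)]; last by rewrite inE pv E !eqxx.
    by rewrite inE => /andP[/eqP + /eqP pw]; rewrite pw E.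
  by move=> _; case: pickP => // w; rewrite inE => /andP[/eqP + /eqP pw]; rewrite pw E.
apply: eq_big => [e|e].
  rewrite (_ : _ \in family _); last by apply/familyP => j; exact: okC.
  apply/eqP/imset_injP => [CT v w|inj].
    by rewrite -CT !inE => /eqP + /eqP + pvw; rewrite pvw => -> [].
  apply/setP=> v; rewrite !inE ffunE; case: pickP => [w /andP[we /eqP pw]|/(_ v)].
    apply/eqP/idP => [[<-]//|ve]; congr Some; exact: inj.
  by rewrite eqxx andbT => ->.
move=> /andP[_ /eqP CT]; rewrite (partition_big p predT) //=.
apply: eq_bigr => j _; rewrite ffunE; case: pickP => [w /andP[we /eqP pw]|e0].
  rewrite (big_pred1 w) // => v; apply/andP/eqP => [[]|->]; last by rewrite pw.
  move: we; rewrite -CT !inE !ffunE pw => /eqP wj /eqP vj /eqP pv.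
  by move: vj; rewrite pv wj => -[].
by rewrite big_pred0.
Qed.

(** The right side is the elementary symmetric polynomial [e_r] of the part sums. Giving each vertex
    the weight [x v *: 'X] makes the degree record [#|e|]. *)
Lemma edge_sum_multipartite (F : comNzRingType) (r t : nat) (V : finType)
    (p : V -> 'I_t) (x : V -> F) :
  edge_sum (multipartite r p) x = (\prod_j (1 + part_sum x p j *: 'X))`_r.
Proof.
transitivity ((\sum_(e : {set V} | #|p @: e| == #|e|)
                 \prod_(v in e) (x v *: 'X))`_r).
  rewrite coef_sum [RHS](bigID (fun e : {set V} => #|e| == r)) /=.
  rewrite [X in _ + X]big1 ?addr0 => [|e /andP[_ er]]; last first.
    by rewrite scaler_prod prodr_const coefZ coefXn eq_sym (negPf er) mulr0.
  apply: eq_big => [e|e]; first by rewrite inE andbC.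
  rewrite inE => /andP[/eqP er _].
  by rewrite scaler_prod prodr_const coefZ coefXn er eqxx mulr1.
rewrite -(prod_transversal p) (eq_bigr (fun j => 1 + part_sum x p j *: 'X)) // => j _.
by rewrite /part_sum scaler_suml.
Qed.

(** Raising [x i] by 1 adds the link sum to the form and adds 1 to the part sum of [p i] alone;
    comparing coefficients isolates the product over the other parts. *)
Lemma link_sum_multipartite (F : comNzRingType) (r t : nat) (V : finType)
    (p : V -> 'I_t) (x : V -> F) i : (0 < r)%N ->
  link_sum (multipartite r p) x i
    = (\prod_(j | j != p i) (1 + part_sum x p j *: 'X))`_r.-1.
Proof.
move=> r0; apply: (addrI (edge_sum (multipartite r p) x)).
rewrite -[link_sum _ _ _]mul1r -edge_sum_shift !edge_sum_multipartite.
rewrite (bigD1 (p i)) //= [in RHS](bigD1 (p i)) //=.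
set y := fun v => _.
have yE j : part_sum y p j = part_sum x p j + (j == p i)%:R.
  rewrite /part_sum !(big_mkcond (fun v => _ == j)) (bigD1 i) //=.
  rewrite [in RHS](bigD1 i) //= /y eqxx -addrA [_ + (_ == _)%:R]addrC addrA.
  congr (_ + _); last by apply: eq_bigr => v /negPf ->.
  by rewrite (eq_sym j); case: eqP; rewrite ?addr0.
rewrite yE eqxx (eq_bigr (fun j => 1 + part_sum x p j *: 'X)) => [|j /negPf ji]; last first.
  by rewrite yE ji addr0.
rewrite scalerDl scale1r addrA mulrDl coefD; congr (_ + _).
by rewrite coefXM gtn_eqF.
Qed.

Section CoefPositivity.
Variables (F : realDomainType) (I : Type) (y : I -> F) (P : pred I).
Hypothesis y0 : forall i, 0 <= y i.

Lemma coef_prod_ge0 s k : 0 <= (\prod_(i <- s | P i) (1 + y i *: 'X))`_k.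
Proof.
elim: s k => [|i s IH] k; first by rewrite big_nil coef1 ler0n.
rewrite big_cons; case: ifP => // _; rewrite mulrDl mul1r coefD -scalerAl coefZ coefXM.
by rewrite addr_ge0 // mulr_ge0 //; case: k.
Qed.

(** The coefficient is [e_k] of nonnegative numbers, positive exactly when at least [k] of them are
    positive. *)
Lemma coef_prod_gt0 s k :
  (0 < (\prod_(i <- s | P i) (1 + y i *: 'X))`_k)
    = (k <= count (fun i => P i && (0 < y i)%R) s)%N.
Proof.
elim: s k => [|i s IH] k; first by rewrite big_nil coef1 ltr0n; case: k.
rewrite big_cons /=; case: ifP => _ /=; last by rewrite add0n.
rewrite mulrDl mul1r coefD -scalerAl coefZ coefXM; case: k => [|k] /=.
  by rewrite mulr0 addr0 IH !leq0n.
have := y0 i; rewrite le_eqVlt => /predU1P[<-|yi].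
  by rewrite mul0r addr0 ltxx add0n IH.
rewrite yi add1n ltnS; have := coef_prod_ge0 s k.+1.
rewrite le_eqVlt => /predU1P[E|].
  by rewrite -E add0r pmulr_rgt0 // IH.
move=> gt; have le := gt; rewrite IH in le.
by rewrite (ltnW le) ltr_pwDl // mulr_ge0 ?(ltW yi) ?coef_prod_ge0.
Qed.

End CoefPositivity.

(* [z1] and [z2] are the weights of the vertices in two parts of sizes [a] and
   [b]. The eigenvalue equations force [a z1^r >= b z2^r]; with [z1 < z2] this
   gives [a z1^2 >= b z2^2], which is incompatible with [(a - 1) z1 <= b z2]
   because [(a - 1)^2 > a b]. *)
Lemma larger_part_dominates (F : realFieldType) (k : nat)
    (a b rho A B z1 z2 : F) :
    0 <= b -> b + 2 <= a -> 0 < rho -> 0 < A -> 0 <= B -> 0 < z1 -> 0 < z2 ->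
    rho * z1 ^+ k.+1 = B + b * z2 * A -> rho * z2 ^+ k.+1 = B + a * z1 * A ->
  b * z2 < a * z1 - z1.
Proof.
move=> b0 ba rho0 A0 B0 z10 z20 e1 e2; rewrite ltNge; apply/negP => le.
have z12 : z1 < z2.
  rewrite ltNge; apply/negP => z21.
  have : (b + 1) * z1 <= (a - 1) * z1 by rewrite ler_wpM2r ?(ltW z10) //; lra.
  have : b * z2 <= b * z1 by rewrite ler_wpM2l.
  lra.
(* Otherwise the right side of the first equation would exceed that of the second, forcing
   [z2 < z1]. *)
have bz : b * z2 <= a * z1.
  rewrite leNgt; apply/negP => gt.
  have : rho * z2 ^+ k.+1 < rho * z1 ^+ k.+1 by rewrite e1 e2 ltrD2l ltr_pM2r.
  rewrite ltr_pM2l // ltr_pXn2r // ?nnegrE ?ltW // => z21.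
  by have := lt_trans z12 z21; rewrite ltxx.
(* Multiplying the equations by [a * z1] and [b * z2] produces the same term [a * b * z1 * z2 * A],
   so only the multiples of [B] are compared. *)
have c1 : b * z2 ^+ k.+2 <= a * z1 ^+ k.+2.
  rewrite -(ler_pM2l rho0).
  have -> : rho * (b * z2 ^+ k.+2) = (b * z2) * (rho * z2 ^+ k.+1).
    by rewrite [z2 ^+ k.+2]exprS; ring.
  have -> : rho * (a * z1 ^+ k.+2) = (a * z1) * (rho * z1 ^+ k.+1).
    by rewrite [z1 ^+ k.+2]exprS; ring.
  rewrite e1 e2; have := ler_wpM2l B0 bz; lra.
have c2 : b * z2 ^+ 2 <= a * z1 ^+ 2.
  have zk : 0 < z2 ^+ k by rewrite exprn_gt0.
  have a0 : 0 <= a by lra.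
  rewrite -(ler_pM2r zk) -[X in X <= _]mulrA -exprD; apply: le_trans c1 _.
  rewrite -[k.+2]add2n exprD mulrA ler_wpM2l ?mulr_ge0 ?exprn_ge0 ?(ltW z10) //.
  by rewrite lerXn2r ?nnegrE ?ltW.
have z1sq : 0 < z1 ^+ 2 by rewrite exprn_gt0.
have c3 : ((a - 1) * z1) ^+ 2 <= (b * z2) ^+ 2.
  by rewrite ler_pXn2r ?nnegrE ?mulr_ge0 ?(ltW z10) ?(ltW z20) //; lra.
have c4 : b * (b * z2 ^+ 2) <= b * (a * z1 ^+ 2) by rewrite ler_wpM2l.
have : (a - 1) ^+ 2 * z1 ^+ 2 <= (a * b) * z1 ^+ 2.
  have -> : a * b * z1 ^+ 2 = b * (a * z1 ^+ 2) by ring.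
  by apply: le_trans c4; rewrite -exprMn mulrA -expr2 -exprMn.
rewrite ler_pM2r // => c5.
have : a * b <= a * (a - 2) by rewrite ler_wpM2l //; lra.
have -> : a * (a - 2) = (a - 1) ^+ 2 - 1 by ring.
lra.
Qed.

Lemma coef_linear_mul (F : comNzRingType) (c : F) (q : {poly F}) k :
  ((1 + c *: 'X) * q)`_k.+1 = q`_k.+1 + c * q`_k.
Proof. by rewrite mulrDl mul1r coefD -scalerAl coefZ coefXM. Qed.

Section Reassign.
Variables (R : realType) (r t : nat) (V : finType) (p : V -> 'I_t).
Hypotheses (r2 : (2 <= r)%N) (rt : (r <= t)%N).
Hypothesis psurj : forall j, (0 < part_size p j)%N.

Lemma spectral_radius_lt_reassign (v : V) (j : 'I_t) :
    (part_size p j + 2 <= part_size p (p v))%N ->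
  spectral_radius R (multipartite r p)
    < spectral_radius R (multipartite r (reassign p v j)).
Proof.
move=> sizes; set H := multipartite r p; set i := p v.
have V0 : (0 < #|V|)%N by apply/card_gt0P; exists v.
have ji : j != i by apply: contraTneq sizes => ->; rewrite addn2 -ltnNge leqW.
have r0 : (0 < r)%N by exact: ltn_trans r2.
have [x [x0 sx xE ub]] := spectral_radius_eigenvector R H r2 V0.
set rho := spectral_radius R H in xE ub *.
have y0 k : 0 <= part_sum x p k by exact: sumr_ge0.
have cnt (P : pred 'I_t) (z : V -> R) : (forall u, 0 < z u) ->
    count (fun k => P k && (0 < part_sum z p k)) (index_enum 'I_t) = #|P|.
  move=> z0; rewrite cardE size_filter; apply: eq_count => k.
  rewrite -[RHS]andbT; congr (_ && _).
  have /card_gt0P[u] := psurj k; rewrite inE => uk.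
  rewrite /part_sum (bigD1 u) //= ltr_pwDl // sumr_ge0 // => w _.
  exact: ltW.
have edgeE : edge_sum H x *+ r = rho * \sum_u x u ^+ r.
  rewrite -euler_edge_sum mulr_sumr; apply: eq_bigr => u _.
  by rewrite xE mulrCA -exprS prednK.
(* The all-ones vector is the trial vector; its form is positive since at least [r] parts are
   nonempty. *)
have rho0 : 0 < rho.
  have q1 : 0 < edge_sum H (fun=> 1 : R).
    rewrite edge_sum_multipartite coef_prod_gt0 => [|k]; last exact: sumr_ge0.
    by rewrite (cnt predT) // card_ord.
  have := ub (fun=> 1) (fun=> ler01); under [\sum_u _]eq_bigr do rewrite expr1n.
  rewrite sumr_const; apply: contraTT; rewrite -leNgt -ltNge => rhole.
  apply: (@le_lt_trans _ _ 0); last by rewrite pmulrn_lgt0.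
  by rewrite mulr_le0_ge0.
have edge0 : 0 < edge_sum H x by rewrite -(pmulrn_lgt0 _ r0) edgeE mulr_gt0.
(* If [x u = 0], the link sum at [u] is 0. But a positive form needs [r] parts of positive sum,
   hence [r.-1] of them besides that of [u], which makes this link sum positive. *)
have xpos u : 0 < x u.
  rewrite lt_def x0 andbT; apply/eqP => xu.
  have := xE u; rewrite xu expr0n (_ : (r.-1 == 0%N) = false) ?mulr0; last first.
    by case: (r) r2 => [|[]].
  apply/eqP; rewrite gt_eqF // link_sum_multipartite // coef_prod_gt0 //.
  move: edge0; rewrite edge_sum_multipartite (coef_prod_gt0 _ y0) /= => le.
  rewrite -ltnS prednK //; apply: leq_trans le _.
  have c1 : count (pred1 (p u)) (index_enum 'I_t) = 1%N.
    by rewrite count_uniq_mem ?index_enum_uniq // mem_index_enum.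
  rewrite -addn1 -[X in (_ <= _ + X)%N]c1 -count_predUI.
  apply: leq_trans (leq_addr _ _); apply: sub_count => k /=.
  by case: (k == p u); rewrite ?orbT ?orbF.
(* The link sum at a vertex depends only on its part, so the eigenvalue equation makes [x] constant
   on parts. *)
have y1 u : part_sum x p (p u) = x u *+ part_size p (p u).
  have const w : p w == p u -> x w = x u.
    move=> /eqP wu; apply/eqP; rewrite -(@eqrXn2 _ r.-1) // -?subn1 ?subn_gt0 // subn1.
    apply/eqP/(mulfI (lt0r_neq0 rho0)).
    by rewrite -!xE !link_sum_multipartite // wu.
  by rewrite /part_sum (eq_bigr _ const) sumr_const.
(* [Q] gathers the parts other than [i] and [j], which the move leaves unchanged; [A] and [B] are
   [e_{r-2}] and [e_{r-1}] of their sums. *)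
pose Q := \prod_(k | (k != i) && (k != j)) (1 + part_sum x p k *: 'X).
pose A := Q`_r.-2; pose B := Q`_r.-1.
have A0 : 0 < A.
  rewrite coef_prod_gt0 // cnt //.
  rewrite (eq_card (B := [predC pred2 i j])) => [|k]; last by rewrite !inE negb_or.
  rewrite -[X in (_ <= X)%N](addKn 2) (_ : (2 + _)%N = t) ?leq_sub2r //; first by lia.
  by rewrite -[RHS]card_ord -(cardC (pred2 i j)) card2 eq_sym ji.
have B0 : 0 <= B by exact: coef_prod_ge0.
have [w wj] : exists w, p w = j.
  by have /card_gt0P[w] := psurj j; rewrite inE => /eqP; exists w.
have r1E : r.-1 = r.-2.+1 by case: (r) r2 => [|[]].
have e1 : rho * x v ^+ r.-1 = B + part_sum x p j * A.
  rewrite -xE link_sum_multipartite // (bigD1 j) //= r1E coef_linear_mul.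
  by rewrite -r1E.
have e2 : rho * x w ^+ r.-1 = B + part_sum x p i * A.
  rewrite -xE link_sum_multipartite // wj (bigD1 i) 1?eq_sym //= r1E coef_linear_mul.
  by rewrite -r1E (eq_bigl _ _ (fun k => andbC _ _)).
have gain : part_sum x p j < part_sum x p i - x v.
  rewrite -wj /i !y1 wj -[x w *+ _]mulr_natl -[x v *+ _]mulr_natl.
  apply: (@larger_part_dominates _ r.-2 _ _ rho A B); rewrite ?xpos ?ler0n //.
    by rewrite -natrD ler_nat.
    by rewrite -r1E e1 -wj y1 wj mulr_natl.
  by rewrite -r1E e2 mulr_natl -y1.
have [_ [_ _ _ ub']] :=
  spectral_radius_eigenvector R (multipartite r (reassign p v j)) r2 V0.
rewrite -(ltr_pM2r sx) -edgeE; apply: lt_le_trans (ub' x x0).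
rewrite ltrMn2r r0 /= !edge_sum_multipartite.
have split (z : 'I_t -> R) : (\prod_k (1 + z k *: 'X))`_r =
    let q := \prod_(k | (k != i) && (k != j)) (1 + z k *: 'X) in
    q`_r + (z i + z j) * q`_r.-1 + z i * z j * q`_r.-2.
  rewrite (bigD1 i) //= (bigD1 j) //= -(prednK r0) coef_linear_mul r1E.
  by rewrite !coef_linear_mul /=; ring.
have reE k := part_sum_reassign x k ji.
have yi : part_sum x (reassign p v j) i = part_sum x p i - x v.
  by have := reE i; rewrite eqxx eq_sym (negPf ji) addr0 => <-; rewrite addrK.
have yj : part_sum x (reassign p v j) j = part_sum x p j + x v.
  by have := reE j; rewrite eqxx (negPf ji) addr0.
rewrite !split /= yi yj.
rewrite [\prod_(k | _) (1 + part_sum x (reassign p v j) k *: 'X)](_ : _ = Q); last first.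
  apply: eq_bigr => k /andP[/negPf ki /negPf kj].
  by have := reE k; rewrite -/i ki kj !addr0 => ->.
rewrite -/Q -/A -/B -subr_gt0.
(* The sum of the two part sums is preserved, so only their product changes; the gain is
   [c * (a - c - b) * A] with [c = x v], positive by [gain]. *)
have -> : forall a b c q, q + (a - c + (b + c)) * B + (a - c) * (b + c) * A
   - (q + (a + b) * B + a * b * A) = c * (a - c - b) * A by move=> a b c q; ring.
by rewrite !mulr_gt0 ?xpos // subr_gt0.
Qed.

End Reassign.

(** * Extremal partitions *)

Section Extremal.
Variables (R : realType) (r t : nat) (V : finType).
Hypotheses (r2 : (2 <= r)%N) (rt : (r <= t)%N).
Implicit Types p q : V -> 'I_t.

Definition nonempty_parts p := forall j, (0 < part_size p j)%N.

(** There are finitely many partitions, seen as finite functions. An arbitrary [f] is allowed so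
    that negation also yields a minimizer. *)
Lemma exists_maximal_partition (f : (V -> 'I_t) -> R) p :
    nonempty_parts p ->
  exists2 q, nonempty_parts q & forall q', nonempty_parts q' -> f q' <= f q.
Proof.
pose P (q : {ffun V -> 'I_t}) := [forall j, (0 < part_size q j)%N].
have PE q : P (finfun q) <-> nonempty_parts q.
  rewrite /P (_ : (finfun q : V -> 'I_t) = q); last by apply: funext => v; rewrite ffunE.
  by split=> /forallP.
move=> /PE p0; case: (arg_maxP (fun q : {ffun V -> 'I_t} => f q) p0) => q /forallP q0 qmax.
exists q => // q' /PE /qmax /=.
by rewrite (_ : (finfun q' : V -> 'I_t) = q') //; apply: funext => v; rewrite ffunE.
Qed.

Let rho p := spectral_radius R (multipartite r p).

Lemma maximal_partition_balanced p :
    nonempty_parts p -> (forall q, nonempty_parts q -> rho q <= rho p) ->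
  forall i j, (part_size p i <= (part_size p j).+1)%N.
Proof.
move=> p0 pmax i j; rewrite leqNgt; apply/negP => lt.
have /card_gt0P[v] := p0 i; rewrite inE => /eqP vi.
have ji : j != p v by rewrite vi; apply: contraTneq lt => ->; rewrite -leqNgt leqW.
have := pmax (reassign p v j); rewrite leNgt spectral_radius_lt_reassign //; last first.
  by rewrite vi addn2.
move=> h; suff /h : nonempty_parts (reassign p v j) by [].
move=> k; have := part_size_reassign k ji; have := p0 k; rewrite vi.
by case: eqVneq => [->|_]; case: (_ == j); lia.
Qed.

(** The move is run backwards: if a part [j] besides the largest part [j0] had two vertices, sending
    one of them to [j0] would give [q], from which [p] arises by a balancing move, so
    [rho q < rho p]. *)
Lemma minimal_partition_star p :
    nonempty_parts p -> (forall q, nonempty_parts q -> rho p <= rho q) ->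
  exists j0, forall j, j != j0 -> part_size p j = 1%N.
Proof.
move=> p0 pmin; have t0 : (0 < t)%N by lia.
case: (arg_maxnP (part_size p) (erefl (predT (Ordinal t0)))) => j0 _ jmax.
exists j0 => j jj0; apply/eqP; rewrite eqn_leq p0 andbT leqNgt; apply/negP => gt1.
have /card_gt0P[v] := p0 j; rewrite inE => /eqP vj.
pose q := reassign p v j0.
have qv : q v = j0 by rewrite /q /reassign eqxx.
have j0v : j0 != p v by rewrite vj eq_sym.
have qE k := part_size_reassign k j0v; rewrite -/q vj in qE.
have pE : p = reassign q v j.
  by apply: funext => u; rewrite /q /reassign; case: eqVneq => [->|].
have q0 : nonempty_parts q.
  by move=> k; have := qE k; have := p0 k; case: eqVneq => [->|_]; case: (_ == j0); lia.
have := pmin q q0; rewrite leNgt /rho {1}pE spectral_radius_lt_reassign //.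
rewrite qv; have := qE j; have := qE j0; rewrite !eqxx eq_sym (negPf jj0).
by have := jmax j isT; lia.
Qed.

End Extremal.

Theorem theorem3p3 (R : realType) (r t n : nat)
  (hr : (2 <= r)%N) (hrt : (r <= t)%N) (htn : (t <= n)%N)
  (V : finType) (H : hypergraph r V)
  (hH : in_blowups n (complete_hypergraph r t) H) :
  let S := blowup (complete_hypergraph r t) (@star_sizes n t) in
  let T := turan_hypergraph r t n in
  [/\ (spectral_radius R S <= spectral_radius R H)%R,
      (spectral_radius R H <= spectral_radius R T)%R,
      spectral_radius R S = spectral_radius R H <-> isomorphic H S &
      spectral_radius R H = spectral_radius R T <-> isomorphic H T].
Proof.
move=> S T; case: hH => ns [ns0 nsn isoB].
pose p (v : blowup_vertex ns) := tag v.
have isoH : isomorphic H (multipartite r p).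
  exact: isomorphic_trans isoB (isomorphic_blowup_complete _ _).
have pE : part_size p =1 ns by move=> j; exact: part_size_tag.
have p0 : nonempty_parts p by move=> j; rewrite pE.
have cardB : #|blowup_vertex ns| = n.
  by rewrite -(sum_part_size p) -nsn; apply: eq_bigr => j _; rewrite pE.
have B0 : (0 < #|blowup_vertex ns|)%N by lia.
have rhoE := isomorphic_spectral_radius R hr.
have V0 : (0 < #|V|)%N by have [f fB _] := isoB; rewrite (bij_eq_card fB).
pose rho q := spectral_radius R (multipartite r (q : blowup_vertex ns -> 'I_t)).
have rhoH : spectral_radius R H = rho p by exact: rhoE.
have maxT q : nonempty_parts q -> (forall q', nonempty_parts q' -> rho q' <= rho q) ->
    isomorphic (multipartite r q) T.
  move=> q0 qmax; rewrite /T -cardB; apply: balanced_isomorphic_turan; first lia.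
  exact: maximal_partition_balanced qmax.
have minS q : nonempty_parts q -> (forall q', nonempty_parts q' -> rho q <= rho q') ->
    isomorphic (multipartite r q) S.
  move=> q0 qmin; have [j0 qj] := minimal_partition_star hr hrt q0 qmin.
  by rewrite /S -cardB; apply: star_isomorphic qj _.
(* Extremal partitions exist and are isomorphic to [T] and [S], so these two attain the maximum and
   the minimum. In case of equality [p] is itself extremal, and [maxT] or [minS] applies to it. *)
have [q q0 qmax] := exists_maximal_partition rho p0.
have [q' q'0 qmin] := exists_maximal_partition (fun q => - rho q) p0.
have {}qmin q'' : nonempty_parts q'' -> rho q' <= rho q''.
  by move=> /qmin; rewrite lerN2.
have rhoT : spectral_radius R T = rho q by apply/esym/rhoE/maxT.
have rhoS : spectral_radius R S = rho q' by apply/esym/rhoE/minS.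
rewrite rhoH rhoT rhoS; split; [exact: qmin|exact: qmax|split|split].
- move=> e; apply: isomorphic_trans isoH _; apply: minS => // q'' q''0.
  by rewrite -e; exact: qmin.
- by move=> isoS; rewrite -rhoS -rhoH; apply/esym/rhoE.
- move=> e; apply: isomorphic_trans isoH _; apply: maxT => // q'' q''0.
  by rewrite e; exact: qmax.
- by move=> isoT; rewrite -rhoT -rhoH; apply: rhoE.
Qed.
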